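(* Let $C\in\mathbb C^{N\times N}$ be the true covariance matrix, let $C_\delta\in\mathbb C^{N\times N}$ be a Hermitian perturbation, and let $\tilde C=C+C_\delta$. Let $1\le K<N$, and let the singular values of $C$ satisfy $\lambda_1>\cdots>\lambda_K>\lambda_{K+1}>\cdots>\lambda_N\ge0$, with $\delta_K=\lambda_K-\lambda_{K+1}$. Let $\hat\phi$ be the random discrete contrast source and $\tilde\phi_K$ its orthogonal projection onto the subspace $\tilde{\mathcal S}_K$ spanned by the first $K$ left singular vectors of $\tilde C$ (as defined in the context). Then $$\mathbb E\left[\|\hat\phi-\tilde\phi_K\|_2\right]\le\sqrt{\varepsilon_K}+\frac{2\|C_\delta\|_2}{\delta_K}\sqrt{\varepsilon_0},\qquad\text{where }\ \varepsilon_i=\sum_{n=i+1}^N\lambda_n .$$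
   Context: $C\in\mathbb C^{N\times N}$ is a covariance matrix, i.e. Hermitian positive semidefinite. Write singular value decompositions $C=\mathbb U\mathbb S\mathbb V^H$ and $\tilde C=\tilde{\mathbb U}\tilde{\mathbb S}\tilde{\mathbb V}^H$, with singular values in decreasing order, and let $\zeta_1,\dots,\zeta_N$ and $\psi_1,\dots,\psi_N$ be the (orthonormal) columns of $\mathbb U$ and $\tilde{\mathbb U}$, respectively. Set $\tilde{\mathcal S}_K=\operatorname{span}\{\psi_1,\dots,\psi_K\}$. The discrete contrast source is the random vector $\hat\phi=\sum_{n=1}^N a_n\sqrt{\lambda_n}\,\zeta_n\in\mathbb C^N$, where $a_1,\dots,a_N$ are random variables with zero mean and variance $1$. The vector $\tilde\phi_K$ is the orthogonal projection of $\hat\phi$ onto $\tilde{\mathcal S}_K$. $\|\cdot\|_2$ denotes the Euclidean norm for vectors and the spectral norm for matrices. *)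

(* Defs.v *)
From HB Require Import structures.
From mathcomp Require Import all_boot all_order all_algebra.
From mathcomp Require Import spectral.
From mathcomp Require Import all_classical all_reals all_analysis.
From mathcomp Require Import complex.

Set Implicit Arguments.
Unset Strict Implicit.
Unset Printing Implicit Defensive.

Import Order.TTheory GRing.Theory Num.Theory.
Import numFieldNormedType.Exports.

Local Open Scope classical_set_scope.
Local Open Scope ring_scope.
Local Open Scope complex_scope.
Local Open Scope sesquilinear_scope.

(* The modulus of a complex number, as a real number. *)
Notation cmod := ComplexField.Normc.normc.

Section Matrices.
Variable R : realType.
Local Notation C := R[i].

Definition l2norm n (x : 'cV[C]_n) : R := Num.sqrt (\sum_i cmod (x i 0) ^+ 2).

Definition spectral_norm m n (A : 'M[C]_(m, n)) : R :=
  sup [set l2norm (A *m x) | x in [set x : 'cV[C]_n | l2norm x <= 1]].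

(* 0 <= z in R[i] means that z is real and nonnegative. *)
Definition psdmx n (A : 'M[C]_n) : Prop :=
  A \is hermsymmx /\ forall x : 'cV[C]_n, 0 <= (x^t* *m A *m x) 0 0.

(* Singular values are indexed from 1, as s 1, ..., s n; the other values of s
   play no role.  They go with the 0-based columns of U: s j.+1 with col j U. *)
Definition is_svd n (A U : 'M[C]_n) (s : nat -> R) (V : 'M[C]_n) : Prop :=
  [/\ U \is unitarymx,
      V \is unitarymx,
      (forall i, (1 <= i <= n)%N -> 0 <= s i),
      (forall i j, (1 <= i)%N -> (i <= j)%N -> (j <= n)%N -> s j <= s i)
    & A = U *m diag_mx (\row_(j < n) (s j.+1)%:C) *m V^t*].

(* proj_ortho acts on row vectors, hence the transpositions; rows of S^T span
   the transposed column space of S. *)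
Definition orth_proj n m (S : 'M[C]_(n, m)) (x : 'cV[C]_n) : 'cV[C]_n :=
  (x^T *m proj_ortho S^T)^T.

Definition first_cols n (U : 'M[C]_n) K (hK : (K <= n)%N) : 'M[C]_(n, K) :=
  colsub (widen_ord hK) U.

Definition tail_sum N (lam : nat -> R) (i : nat) : R :=
  \sum_(i.+1 <= n < N.+1) lam n.

End Matrices.

Section Probability.
Context d (T : measurableType d) (R : realType) (P : probability T R).
Local Notation C := R[i].

(* Integrability includes measurability. *)
Definition cintegrable (X : T -> C) : Prop :=
  P.-integrable setT (fun w => (complex.Re (X w))%:E) /\
  P.-integrable setT (fun w => (complex.Im (X w))%:E).

Definition cmean (X : T -> C) : C :=
  fine 'E_P[fun w => complex.Re (X w)] +i* fine 'E_P[fun w => complex.Im (X w)].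

Definition cvariance (X : T -> C) : \bar R :=
  'E_P[fun w => cmod (X w - cmean X) ^+ 2].

Definition contrast_source N (U : 'M[C]_N) (lam : nat -> R)
    (a : 'I_N -> T -> C) (w : T) : 'cV[C]_N :=
  \sum_(n < N) (a n w * (Num.sqrt (lam n.+1))%:C) *: col n U.

End Probability.

(* Main.v *)
Require Import Defs.
From HB Require Import structures.
From mathcomp Require Import all_boot all_order all_algebra.
From mathcomp Require Import spectral.
From mathcomp Require Import all_classical all_reals all_analysis.
From mathcomp Require Import complex.
From mathcomp Require Import measurable_realfun.
From mathcomp Require Import ring lra zify.

(* Write E for the perturbation, and U_1 (resp. W_2, Z_2) for the first K columns
   of U (resp. the last N - K left and right singular vectors of C + E).
   Since C is positive semidefinite with distinct singular values, C = U S U^*.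
   Then X = W_2^* U_1 and Y = Z_2^* U_1 satisfy
     X S_1 = T_2 Y - W_2^* E U_1   and   Y S_1 = T_2 X - Z_2^* E U_1,
   and Weyl's inequality bounds T_2 by lambda_(K+1) + |E|, hence Wedin's
   sin-theta bound: delta_K max(|X|, |Y|) <= 2 |E|.  The projection error splits
   as a term <= |X| |phi| and a term bounded by the tail of phi; their means are
   controlled by second moments, through sqrt s <= s / (2 t) + t / 2.
   Submatrices are encoded as N x N matrices multiplied by diagonal 0/1 masks. *)

Set Implicit Arguments.
Unset Strict Implicit.
Unset Printing Implicit Defensive.

Import Order.TTheory GRing.Theory Num.Theory.
Import numFieldNormedType.Exports.

Local Open Scope classical_set_scope.
Local Open Scope ring_scope.
Local Open Scope complex_scope.
Local Open Scope sesquilinear_scope.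

(** * Euclidean norm, unitary invariance and the spectral norm *)

Section L2norm.
Variable R : realType.
Local Notation C := R[i].

Lemma normc_cmod (z : C) : `|z| = (cmod z)%:C.
Proof. by []. Qed.

Lemma cmod_ge0 (z : C) : 0 <= cmod z.
Proof. by rewrite -lecR -normc_cmod normr_ge0. Qed.

Lemma cmod_real (r : R) : cmod r%:C = `|r|.
Proof. by rewrite /= expr0n addr0 sqrtr_sqr. Qed.

Lemma l2norm_ge0 n (x : 'cV[C]_n) : 0 <= l2norm x.
Proof. exact: sqrtr_ge0. Qed.

Lemma sqr_l2norm n (x : 'cV[C]_n) :
  l2norm x ^+ 2 = \sum_i cmod (x i 0) ^+ 2.
Proof. by rewrite sqr_sqrtr// sumr_ge0// => i _; rewrite sqr_ge0. Qed.

Lemma l2norm_dot n (x : 'cV[C]_n) : (l2norm x ^+ 2)%:C = (x^t* *m x) 0 0.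
Proof.
rewrite sqr_l2norm mxE rmorph_sum/=; apply: eq_bigr => i _.
by rewrite !mxE rmorphXn/= -normc_cmod normCKC.
Qed.

Lemma l2norm_scale_le n (c : R) (x y : 'cV[C]_n) : 0 <= c ->
  (forall i, cmod (x i 0) <= c * cmod (y i 0)) -> l2norm x <= c * l2norm y.
Proof.
move=> c0 xy; rewrite -(@ler_pXn2r _ 2)// ?nnegrE ?mulr_ge0 ?l2norm_ge0//.
rewrite exprMn !sqr_l2norm mulr_sumr ler_sum// => i _; rewrite -exprMn.
by rewrite ler_pXn2r// ?nnegrE ?mulr_ge0 ?cmod_ge0.
Qed.

Lemma l2norm_mono n (x y : 'cV[C]_n) :
  (forall i, cmod (x i 0) <= cmod (y i 0)) -> l2norm x <= l2norm y.
Proof.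
by move=> xy; rewrite -[leRHS]mul1r l2norm_scale_le// => i; rewrite mul1r.
Qed.

Lemma l2normZ n (a : C) (x : 'cV[C]_n) : l2norm (a *: x) = cmod a * l2norm x.
Proof.
apply/eqP; rewrite -(@eqrXn2 _ 2)// ?mulr_ge0 ?l2norm_ge0 ?cmod_ge0//.
rewrite exprMn !sqr_l2norm mulr_sumr; apply/eqP/eq_bigr => i _.
by rewrite mxE ComplexField.Normc.normcM exprMn.
Qed.

Lemma l2norm_eq0 n (x : 'cV[C]_n) : l2norm x = 0 -> x = 0.
Proof.
move=> x0; apply/colP => i; rewrite mxE; apply: ComplexField.Normc.eq0_normc.
apply/eqP; have := sqr_l2norm x; rewrite x0 expr0n/= => /esym/eqP.
rewrite psumr_eq0 => [/allP/(_ i)|j _]; last exact: sqr_ge0.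
by rewrite mem_index_enum sqrf_eq0 => /(_ isT).
Qed.

Lemma l2norm0 n : l2norm (0 : 'cV[C]_n) = 0.
Proof. by rewrite -(scale0r 0) l2normZ ComplexField.Normc.normc0 mul0r. Qed.

Lemma l2normN n (x : 'cV[C]_n) : l2norm (- x) = l2norm x.
Proof.
by rewrite -scaleN1r l2normZ normcN ComplexField.Normc.normc1 mul1r.
Qed.

Lemma cmod_le_l2norm n (x : 'cV[C]_n) i : cmod (x i 0) <= l2norm x.
Proof.
rewrite -(@ler_pXn2r _ 2)// ?nnegrE ?cmod_ge0 ?l2norm_ge0//.
by rewrite sqr_l2norm (bigD1 i)//= lerDl sumr_ge0// => j _; rewrite sqr_ge0.
Qed.

Lemma l2normD n (x y : 'cV[C]_n) : l2norm (x + y) <= l2norm x + l2norm y.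
Proof.
have [/l2norm_eq0->|x0] := eqVneq (l2norm x) 0; first by rewrite l2norm0 !add0r.
have [/l2norm_eq0->|y0] := eqVneq (l2norm y) 0; first by rewrite l2norm0 !addr0.
have {x0} x0 : 0 < l2norm x by rewrite lt_def x0 l2norm_ge0.
have {y0} y0 : 0 < l2norm y by rewrite lt_def y0 l2norm_ge0.
rewrite -(@ler_pXn2r _ 2)// ?nnegrE ?addr_ge0 ?l2norm_ge0//.
(* The entrywise bound [(s + t)^2 <= (1 + r) s^2 + (1 + 1/r) t^2] holds for every positive [r]. This
   [r] makes the summed right-hand side exactly the square of the sum of the norms. *)
set r := l2norm y / l2norm x; have r0 : 0 < r by rewrite divr_gt0.
have -> : (l2norm x + l2norm y) ^+ 2 =
    (1 + r) * l2norm x ^+ 2 + (1 + r^-1) * l2norm y ^+ 2.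
  by rewrite /r; field; rewrite !gt_eqF.
rewrite !sqr_l2norm !mulr_sumr -big_split ler_sum// => i _.
rewrite mxE; set s := cmod (x i 0); set t := cmod (y i 0).
apply: (@le_trans _ _ ((s + t) ^+ 2)).
  by rewrite ler_pXn2r// ?nnegrE ?addr_ge0 ?cmod_ge0// le_normcD.
rewrite -subr_ge0.
have -> : (1 + r) * s ^+ 2 + (1 + r^-1) * t ^+ 2 - (s + t) ^+ 2 =
    (r * s - t) ^+ 2 / r by field; rewrite gt_eqF.
by rewrite divr_ge0 ?sqr_ge0// ltW.
Qed.

Lemma l2norm_sum n (I : Type) (r : seq I) (F : I -> 'cV[C]_n) :
  l2norm (\sum_(i <- r) F i) <= \sum_(i <- r) l2norm (F i).
Proof.
elim/big_rec2: _ => [|i x y _ h]; first by rewrite l2norm0.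
by rewrite (le_trans (l2normD _ _))// lerD2l.
Qed.

Lemma unitarymxPV n (U : 'M[C]_n) : U \is unitarymx -> U^t* *m U = 1%:M.
Proof. by rewrite -trmxC_unitary => /unitarymxP; rewrite trmxCK. Qed.

Lemma unitarymx_adj n (U : 'M[C]_n) : U \is unitarymx -> U^t* \is unitarymx.
Proof. by move=> uU; apply/unitarymxP; rewrite trmxCK; exact: unitarymxPV. Qed.

Lemma l2norm_unitary n (U : 'M[C]_n) (x : 'cV[C]_n) :
  U \is unitarymx -> l2norm (U *m x) = l2norm x.
Proof.
move=> uU; apply/eqP; rewrite -(@eqrXn2 _ 2)// ?l2norm_ge0//.
apply/eqP/complexI; rewrite !l2norm_dot trmx_mul map_mxM mulmxA.
by rewrite -(mulmxA _ (U^t*)) (unitarymxPV uU) mulmx1.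
Qed.

(** The sum of the norms of the columns is an upper bound, since each coordinate of a vector of the
    unit ball has modulus at most 1. Without boundedness [sup] would carry no information. *)
Lemma spectral_norm_has_sup m n (A : 'M[C]_(m, n)) :
  has_sup [set l2norm (A *m x) | x in [set x : 'cV[C]_n | l2norm x <= 1]].
Proof.
split; first by exists (l2norm (A *m 0)), 0 => //=; rewrite l2norm0.
exists (\sum_j l2norm (col j A)) => _ [x /= x1 <-].
have -> : A *m x = \sum_j x j 0 *: col j A.
  apply/colP => i; rewrite mxE summxE; apply: eq_bigr => j _.
  by rewrite !mxE mulrC.
apply: le_trans (l2norm_sum _ _) _; apply: ler_sum => j _.
rewrite l2normZ ler_piMl ?l2norm_ge0//.
exact: le_trans (cmod_le_l2norm _ _) x1.
Qed.

Lemma spectral_norm_ge0 m n (A : 'M[C]_(m, n)) : 0 <= spectral_norm A.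
Proof.
apply: ub_le_sup; first by case: (spectral_norm_has_sup A).
by exists 0; rewrite /= ?mulmx0 l2norm0.
Qed.

Lemma l2norm_mulmx m n (A : 'M[C]_(m, n)) (x : 'cV[C]_n) :
  l2norm (A *m x) <= spectral_norm A * l2norm x.
Proof.
have [/l2norm_eq0->|x0] := eqVneq (l2norm x) 0.
  by rewrite mulmx0 !l2norm0 mulr0.
have {x0} x0 : 0 < l2norm x by rewrite lt_def x0 l2norm_ge0.
have cx : cmod (l2norm x)^-1%:C = (l2norm x)^-1.
  by rewrite cmod_real ger0_norm// invr_ge0 ltW.
rewrite -ler_pdivrMr// mulrC -{1}cx -l2normZ scalemxAr.
apply: ub_le_sup; first by case: (spectral_norm_has_sup A).
by exists ((l2norm x)^-1%:C *: x); rewrite //= l2normZ cx mulVf ?gt_eqF.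
Qed.

Lemma spectral_norm_le m n (A : 'M[C]_(m, n)) (c : R) : 0 <= c ->
  (forall x, l2norm (A *m x) <= c * l2norm x) -> spectral_norm A <= c.
Proof.
move=> c0 Ac; apply: ge_sup; first by case: (spectral_norm_has_sup A).
by move=> _ [x /= x1 <-]; rewrite (le_trans (Ac x))// ler_piMr.
Qed.

End L2norm.

(** * Singular value decompositions and their perturbation *)

Section SingularVectors.
Variables (R : realType) (N : nat).
Local Notation C := R[i].
Implicit Types (U V W Z A E : 'M[C]_N) (s t : nat -> R) (x y : 'cV[C]_N).

Definition sdiag s : 'M[C]_N := diag_mx (\row_(j < N) (s j.+1)%:C).

Definition mask (p : pred nat) : 'M[C]_N := diag_mx (\row_(j < N) (p j)%:R).

Lemma sdiagE s x i : (sdiag s *m x) i 0 = (s i.+1)%:C * x i 0.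
Proof. by rewrite mul_diag_mx !mxE. Qed.

Lemma maskE p x i : (mask p *m x) i 0 = (p i)%:R * x i 0.
Proof. by rewrite mul_diag_mx !mxE. Qed.

Lemma adj_mul m n p (A : 'M[C]_(m, n)) (B : 'M[C]_(n, p)) :
  (A *m B)^t* = B^t* *m A^t*.
Proof. by rewrite trmx_mul map_mxM. Qed.

Lemma sdiag_adj s : (sdiag s)^t* = sdiag s.
Proof.
apply/matrixP => i j; rewrite !mxE eq_sym; case: eqP => [->|_].
  by rewrite !mulr1n conj_Creal// complex_real.
by rewrite !mulr0n rmorph0.
Qed.

Lemma hermsymmx_adj A : A \is hermsymmx -> A^t* = A.
Proof. by move=> /is_hermitianmxP {2}->; rewrite expr0 scale1r. Qed.

(** Take adjoints: [sdiag s] is real, so the left and right singular vectors of a Hermitian matrix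
    can be exchanged. *)
Lemma herm_svd A U V s : A \is hermsymmx -> A = U *m sdiag s *m V^t* ->
  A = V *m sdiag s *m U^t*.
Proof.
move=> hA eA; rewrite -(hermsymmx_adj hA) eA.
by rewrite adj_mul trmxCK adj_mul sdiag_adj mulmxA.
Qed.

(** The first factorization gives [U' A = S V'], the second [A U = V S]; hence
    [U' A A U = S V' V S = S S]. *)
Lemma svd_square (A U U' V V' S : 'M[C]_N) :
  U' *m U = 1%:M -> U *m U' = 1%:M -> V' *m V = 1%:M ->
  A = U *m S *m V' -> A = V *m S *m U' ->
  (U' *m A *m U) *m (U' *m A *m U) = S *m S.
Proof.
move=> hU hU' hV e1 e2.
have UA : U' *m A = S *m V' by rewrite e1 !mulmxA hU mul1mx.
have AU : A *m U = V *m S by rewrite e2 -mulmxA hU mulmx1.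
transitivity (U' *m A *m (U *m U') *m (A *m U)); first by rewrite !mulmxA.
by rewrite hU' mulmx1 AU UA mulmxA -(mulmxA S) hV mulmx1.
Qed.

Lemma mul_sdiagE s A i j : (sdiag s *m A) i j = (s i.+1)%:C * A i j.
Proof. by rewrite mul_diag_mx !mxE. Qed.

Lemma mulr_sdiagE s A i j : (A *m sdiag s) i j = A i j * (s j.+1)%:C.
Proof. by rewrite mul_mx_diag !mxE. Qed.

(** [A] commutes with its square, which is diagonal with distinct entries, so [A] is diagonal; its
    nonnegative diagonal entries are then determined by their squares. *)
Lemma sqrt_sdiag A s : A *m A = sdiag s *m sdiag s ->
  (forall i : 'I_N, 0 <= A i i) -> (forall i, (i < N)%N -> 0 <= s i.+1) ->
  (forall i j, (i < j)%N -> (j < N)%N -> s j.+1 < s i.+1) ->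
  A = sdiag s.
Proof.
move=> AA A0 s0 ds.
have ss i j : (i < j)%N -> (j < N)%N -> s j.+1 ^+ 2 < s i.+1 ^+ 2.
  move=> ij jN; have iN := ltn_trans ij jN.
  by rewrite ltr_pXn2r ?nnegrE ?s0 ?ds.
have offdiag i j : i != j -> A i j = 0.
  move=> ij; have /matrixP/(_ i j) := mulmxA A A A.
  rewrite AA mulmxA mulr_sdiagE mulr_sdiagE -mulmxA mul_sdiagE mul_sdiagE.
  move/eqP; rewrite -subr_eq0.
  have -> : A i j * (s j.+1)%:C * (s j.+1)%:C -
      (s i.+1)%:C * ((s i.+1)%:C * A i j) =
      A i j * (s j.+1 ^+ 2 - s i.+1 ^+ 2)%:C.
    by rewrite rmorphB/= !rmorphXn/=; ring.
  rewrite mulf_eq0 => /orP[/eqP//|]; rewrite fmorph_eq0 subr_eq0 => /eqP sij.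
  move: ij; rewrite neq_ltn => /orP[] lij;
    by have := ss _ _ lij (ltn_ord _); rewrite sij ltxx.
apply/matrixP => i j; rewrite [RHS]mxE mxE.
have [<-|/offdiag->//] := eqVneq i j.
have Aii : A i i ^+ 2 = (s i.+1)%:C ^+ 2.
  move/matrixP/(_ i i): AA; rewrite mul_sdiagE mxE (bigD1 i)//=.
  by rewrite big1 => [|k ki]; rewrite ?(offdiag k i)// ?mulr0// addr0 !mxE eqxx.
apply/eqP; rewrite mulr1n -(@eqrXn2 _ 2)//.
  by rewrite Aii.
by rewrite ler0c s0.
Qed.

Lemma psd_svdE A U V s : psdmx A -> is_svd A U s V ->
  (forall i j, (1 <= i)%N -> (i < j)%N -> (j <= N)%N -> s j < s i) ->
  A = U *m sdiag s *m U^t*.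
Proof.
move=> [hA pA] [uU uV s0 _ eA] ds; rewrite -/(sdiag s) in eA.
have hU := unitarymxP uU; have hV := unitarymxPV uV.
have hU' := unitarymxPV uU.
have AA := svd_square hU' hU hV eA (herm_svd hA eA).
have <- : U^t* *m A *m U = sdiag s.
  apply: sqrt_sdiag AA _ _ _ => [i|i iN|i j ij jN]; last 2 first.
  - exact: s0.
  - exact: ds.
  (* The diagonal entries of [U^* A U] are the values of the quadratic form of [A] at the columns of
     [U]. *)
  have := pA (U *m delta_mx i 0); rewrite adj_mul.
  have -> : (delta_mx i 0 : 'cV[C]_N)^t* = delta_mx 0 i.
    by rewrite trmx_delta map_delta_mx.
  rewrite mulmxA -(mulmxA _ (U^t*)) -(mulmxA _ (U^t* *m A)).
  by rewrite -rowE -colE !mxE.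
by rewrite mulmxA (mulmxA U) hU mul1mx -mulmxA hU mulmx1.
Qed.

Lemma weyl_sing A C0 E U W Z s t K : (K < N)%N ->
  U \is unitarymx -> W \is unitarymx -> Z \is unitarymx ->
  (forall i, (i < N)%N -> 0 <= s i.+1) ->
  (forall i, (K <= i < N)%N -> s i.+1 <= s K.+1) ->
  (forall i, (i <= K)%N -> 0 <= t K.+1 <= t i.+1) ->
  A = C0 + E -> C0 = U *m sdiag s *m U^t* -> A = W *m sdiag t *m Z^t* ->
  t K.+1 <= s K.+1 + spectral_norm E.
Proof.
move=> KN uU uW uZ s0 sK tK AE eC eA.
(* The K-th row of Q vanishes, so that Q has a nonzero kernel vector y: then
   Z *m y lies in the span of the first K+1 columns of Z and is orthogonal to
   the first K columns of U. *)
pose Q := \matrix_(i < N, j < N) (if (i < K)%N then (U^t* *m Z) i j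
  else if i == Ordinal KN then 0 else (i == j)%:R).
have /det0P[v v0 vQ] : \det Q^T == 0.
  rewrite det_tr (expand_det_row _ (Ordinal KN)) big1// => j _.
  by rewrite mxE/= ltnn eqxx mul0r.
pose y := v^T.
have Qy : Q *m y = 0 by rewrite -[LHS]trmxK trmx_mul trmxK vQ trmx0.
have y0 : 0 < l2norm y.
  rewrite lt_def l2norm_ge0 andbT; apply: contra v0 => /eqP/l2norm_eq0 y0.
  by rewrite -[v]trmxK -/y y0 trmx0.
(* The rows of [Q] after the zero row are rows of the identity, those before it are rows of [U^* Z]:
   this is what [Q y = 0] says in [ylow] and [yhigh]. *)
have ylow (i : 'I_N) : (K < i)%N -> y i 0 = 0.
  move=> Ki; move/colP/(_ i): Qy; rewrite [RHS]mxE mxE => <-.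
  rewrite (bigD1 i)//= big1 => [|j ji]; rewrite [Q _ _]mxE ltnNge (ltnW Ki)/=.
    by rewrite eqxx -val_eqE/= gtn_eqF// mul1r addr0.
  by rewrite -val_eqE/= gtn_eqF// eq_sym (negbTE ji) mul0r.
have yhigh (i : 'I_N) : (i < K)%N -> (U^t* *m (Z *m y)) i 0 = 0.
  move=> iK; move/colP/(_ i): Qy; rewrite [RHS]mxE => <-.
  rewrite mulmxA [LHS]mxE [RHS]mxE.
  by apply: eq_bigr => j _; rewrite [Q _ _]mxE iK.
have hA : t K.+1 * l2norm y <= l2norm (A *m (Z *m y)).
  rewrite eA -mulmxA mulmxA -(mulmxA W) -mulmxA l2norm_unitary//.
  rewrite mulmxA -(mulmxA _ _ Z) unitarymxPV// mulmx1.
  (* For a positive [t K.+1] one may divide by it: [y] is supported on the coordinates [i <= K],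
     where [t i.+1] is at least [t K.+1]. *)
  have [->|tK0] := eqVneq (t K.+1) 0; first by rewrite mul0r l2norm_ge0.
  have {}tK0 : 0 < t K.+1 by rewrite lt_def tK0; have /andP[] := tK K (leqnn _).
  rewrite mulrC -ler_pdivlMr// mulrC; apply: l2norm_scale_le.
    by rewrite invr_ge0 ltW.
  move=> i; rewrite sdiagE ComplexField.Normc.normcM cmod_real ler_pdivlMl//.
  have [iK|Ki] := leqP i K; last by rewrite ylow// ComplexField.Normc.normc0 !mulr0.
  have /andP[h1 h2] := tK i iK.
  by rewrite ler_wpM2r ?cmod_ge0// ger0_norm// (le_trans h1).
have hC : l2norm (C0 *m (Z *m y)) <= s K.+1 * l2norm y.
  rewrite eC -mulmxA -mulmxA l2norm_unitary//.
  (* The norm of [y] is that of [U^* Z y], which is supported on the coordinates [i >= K], where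
     [s i.+1] is at most [s K.+1]. *)
  rewrite -(l2norm_unitary y uZ) -(l2norm_unitary (Z *m y) (unitarymx_adj uU)).
  apply: l2norm_scale_le; first exact: s0.
  move=> i; rewrite sdiagE ComplexField.Normc.normcM cmod_real.
  have [iK|Ki] := ltnP i K.
    by rewrite yhigh// ComplexField.Normc.normc0 !mulr0.
  by rewrite ler_wpM2r ?cmod_ge0// ger0_norm ?s0// sK// Ki/=.
rewrite -(ler_pM2r y0) (le_trans hA)// AE mulmxDl (le_trans (l2normD _ _))//.
by rewrite mulrDl lerD// (le_trans (l2norm_mulmx _ _))// l2norm_unitary.
Qed.

(** Substitute [E = A - C0]: [A] is absorbed on the left through [W' A = T Z'], [C0] on the right
    through [C0 U = U S], and the masks [J], [J'] commute with the diagonal factors. *)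
Lemma sing_intertwine (A C0 E U W' Z' S T J J' : 'M[C]_N) :
  A = C0 + E -> C0 *m U = U *m S -> W' *m A = T *m Z' ->
  J' *m S = S *m J' -> J *m T = T *m J ->
  J *m W' *m U *m J' *m S =
    T *m (J *m Z' *m U *m J') - J *m W' *m E *m U *m J'.
Proof.
move=> AE CU WA JS JT; have -> : E = A - C0 by rewrite AE addrC addKr.
rewrite mulmxBr !mulmxBl -(mulmxA J W' A) WA -(mulmxA _ C0 U) CU.
by rewrite -[LHS]mulmxA JS !mulmxA JT opprB addrC subrK.
Qed.

Lemma l2norm_mask p x : l2norm (mask p *m x) <= l2norm x.
Proof.
apply: l2norm_mono => i; rewrite maskE; case: (p i).
  by rewrite mul1r.
by rewrite mul0r ComplexField.Normc.normc0 cmod_ge0.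
Qed.

Lemma l2norm_sdiag s x (c : R) : 0 <= c ->
  (forall i : 'I_N, x i 0 = 0 \/ `|s i.+1| <= c) ->
  l2norm (sdiag s *m x) <= c * l2norm x.
Proof.
move=> c0 h; apply: l2norm_scale_le => // i.
rewrite sdiagE ComplexField.Normc.normcM cmod_real.
case: (h i) => [->|sc]; first by rewrite ComplexField.Normc.normc0 !mulr0.
by rewrite ler_wpM2r ?cmod_ge0.
Qed.

(** [X] only sees the first K coordinates, where [sdiag s] has an inverse of norm at most [1 / s K];
    [Y] only takes values in the remaining ones, where [sdiag t] has norm at most [t K.+1]. *)
Lemma wedin_step (X Y G : 'M[C]_N) s t K (e : R) :
  0 < s K -> 0 <= e ->
  (forall i, (i < K)%N -> s K <= s i.+1) ->
  (forall i, (K <= i < N)%N -> 0 <= t i.+1 <= t K.+1) -> 0 <= t K.+1 ->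
  X *m mask (fun i => (i < K)%N) = X ->
  mask (fun i => (K <= i)%N) *m Y = Y ->
  (forall x, l2norm (G *m x) <= e * l2norm x) ->
  X *m sdiag s = sdiag t *m Y - G ->
  s K * spectral_norm X <= t K.+1 * spectral_norm Y + e.
Proof.
move=> sK e0 hs ht tK XJ JY hG eX.
have c0 : 0 <= t K.+1 * spectral_norm Y + e.
  by rewrite addr_ge0// mulr_ge0// spectral_norm_ge0.
rewrite mulrC -ler_pdivlMr//; apply: spectral_norm_le => [|x].
  by rewrite divr_ge0// ltW.
(* [sdiag r] inverts [sdiag s] on the first K coordinates and vanishes on the others. The test is
   [i <= K] because coordinate [j] carries [r j.+1]. *)
pose r i := if (i <= K)%N then (s i)^-1 else 0.
have -> : X *m x = X *m sdiag s *m (sdiag r *m x).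
  rewrite -{1}XJ -!mulmxA; congr (_ *m _); apply/colP => i.
  rewrite maskE !sdiagE mulrA /r; case: ltnP => [iK|_].
    rewrite -rmorphM/= divff// gt_eqF// (lt_le_trans sK)//.
    exact: hs.
  by rewrite mulr0.
have hr : l2norm (sdiag r *m x) <= (s K)^-1 * l2norm x.
  apply: l2norm_sdiag; first by rewrite invr_ge0 ltW.
  move=> i; right; rewrite /r; case: ltnP => iK; last first.
    by rewrite normr0 invr_ge0 ltW.
  have si := lt_le_trans sK (hs i iK).
  by rewrite ger0_norm ?invr_ge0 ?(ltW si)// lef_pV2 ?posrE// hs.
apply: (@le_trans _ _ ((t K.+1 * spectral_norm Y + e) * l2norm (sdiag r *m x))).
  rewrite eX; move: (sdiag r *m x) => u.
  rewrite mulmxBl (le_trans (l2normD _ _))// l2normN mulrDl lerD//.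
  rewrite -mulmxA (@le_trans _ _ (t K.+1 * l2norm (Y *m u)))//.
    apply: l2norm_sdiag => // i; case: (ltnP i K) => [iK|Ki]; [left|right].
      by rewrite -JY -mulmxA maskE leqNgt iK mul0r.
    by have /andP[t0 tt] := ht i (introT andP (conj Ki (ltn_ord i)));
      rewrite ger0_norm.
  by rewrite -mulrA ler_wpM2l// l2norm_mulmx.
by rewrite -mulrA ler_wpM2l.
Qed.

End SingularVectors.

(** * The sin-theta bound and the deterministic projection error *)

Section SinTheta.
Variables (R : realType) (N : nat).
Local Notation C := R[i].
Implicit Types (U V W Z A E : 'M[C]_N) (s t : nat -> R) (x y : 'cV[C]_N).

Local Notation hi K := (mask R N (fun i => (K <= i)%N)).
Local Notation lo K := (mask R N (fun i => (i < K)%N)).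

Lemma mask_sdiag p s : mask R N p *m sdiag N s = sdiag N s *m mask R N p.
Proof. exact: diag_mxC. Qed.

Lemma mask_idem p : mask R N p *m mask R N p = mask R N p.
Proof.
rewrite {1 3}/mask mul_diag_mx; apply/matrixP => i j; rewrite !mxE.
by case: (p i); rewrite (mul1r, mul0r) ?mul0rn.
Qed.

Lemma mask_loD_hi K : lo K + hi K = 1%:M.
Proof.
apply/matrixP => i j; rewrite !mxE -mulrnDl ltnNge.
by case: (K <= i)%N; rewrite (addr0, add0r).
Qed.

(* With m = max(p, q): a m <= t m + e <= (b + e) m + e <= b m + 2 e. *)
Lemma wedin_bound (a b t e p q : R) :
  0 <= b -> 0 <= t -> 0 <= e -> 0 <= p -> 0 <= q -> p <= 1 -> q <= 1 ->
  b < a -> t <= b + e -> a * p <= t * q + e -> a * q <= t * p + e ->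
  p * (a - b) <= 2 * e.
Proof.
move=> b0 t0 e0 p0 q0 p1 q1 ba tbe hp hq.
have [pq|qp] := leP p q.
  have : t * p <= (b + e) * q by exact: ler_pM.
  have : p * (a - b) <= q * (a - b) by rewrite ler_wpM2r// subr_ge0 ltW.
  have : e * q <= e by rewrite ler_piMr.
  lra.
have : t * q <= (b + e) * p by apply: ler_pM => //; exact: ltW.
have : e * p <= e by rewrite ler_piMr.
lra.
Qed.

(** [A] may be indefinite, so its left and right singular vectors differ and the estimate for [W]
    involves [Z]. Applying [wedin_step] twice, with [W] and [Z] exchanged, closes the system that
    [wedin_bound] solves. *)
Lemma sin_theta A C0 E U W Z s t K : (0 < K < N)%N ->
  U \is unitarymx -> W \is unitarymx -> Z \is unitarymx ->
  (forall i, (i < N)%N -> 0 <= s i.+1) ->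
  (forall i j, (i <= j < N)%N -> s j.+1 <= s i.+1) ->
  (forall i, (i < N)%N -> 0 <= t i.+1) ->
  (forall i j, (i <= j < N)%N -> t j.+1 <= t i.+1) ->
  s K.+1 < s K ->
  A = C0 + E -> C0 = U *m sdiag N s *m U^t* ->
  A = W *m sdiag N t *m Z^t* -> A = Z *m sdiag N t *m W^t* ->
  spectral_norm (hi K *m W^t* *m U *m lo K) <=
    2 * spectral_norm E / (s K - s K.+1).
Proof.
move=> /andP[K0 KN] uU uW uZ s0 ds t0 dt gap AE eC eA1 eA2.
have weyl : t K.+1 <= s K.+1 + spectral_norm E.
  apply: (weyl_sing KN uU uW uZ s0 _ _ AE eC eA1) => i h; first exact: ds.
  by rewrite t0// dt// h KN.
have sK : 0 < s K by rewrite (le_lt_trans (s0 K KN)).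
(* [s K] sits at coordinate [K.-1], which exists because K is positive. *)
have hs i : (i < K)%N -> s K <= s i.+1.
  by move=> iK; have := ds i K.-1; rewrite (prednK K0); apply; lia.
have ht i : (K <= i < N)%N -> 0 <= t i.+1 <= t K.+1.
  by move=> /andP[Ki iN]; rewrite t0// dt// Ki.
have CU : C0 *m U = U *m sdiag N s.
  by rewrite eC -mulmxA (unitarymxPV uU) mulmx1.
have WA : W^t* *m A = sdiag N t *m Z^t*.
  by rewrite eA1 !mulmxA (unitarymxPV uW) mul1mx.
have ZA : Z^t* *m A = sdiag N t *m W^t*.
  by rewrite eA2 !mulmxA (unitarymxPV uZ) mul1mx.
have adjle V x : V \is unitarymx -> l2norm (V^t* *m x) = l2norm x.
  by move=> uV; rewrite (l2norm_unitary x (unitarymx_adj uV)).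
have G_le V x : V \is unitarymx ->
    l2norm (hi K *m V^t* *m E *m U *m lo K *m x) <= spectral_norm E * l2norm x.
  move=> uV; rewrite -!mulmxA (le_trans (l2norm_mask _ _))// adjle//.
  rewrite (le_trans (l2norm_mulmx _ _))// ler_wpM2l ?spectral_norm_ge0//.
  by rewrite l2norm_unitary// l2norm_mask.
have X_le V : V \is unitarymx -> spectral_norm (hi K *m V^t* *m U *m lo K) <= 1.
  move=> uV; apply: spectral_norm_le => // x; rewrite mul1r -!mulmxA.
  by rewrite (le_trans (l2norm_mask _ _))// adjle// l2norm_unitary// l2norm_mask.
have XJ V : hi K *m V^t* *m U *m lo K *m lo K = hi K *m V^t* *m U *m lo K.
  by rewrite -mulmxA mask_idem.
have JX V : hi K *m (hi K *m V^t* *m U *m lo K) = hi K *m V^t* *m U *m lo K.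
  by rewrite !mulmxA mask_idem.
have hX := wedin_step sK (spectral_norm_ge0 _) hs ht (t0 K KN) (XJ W) (JX Z)
  (fun x => G_le W x uW)
  (sing_intertwine AE CU WA (mask_sdiag _ _) (mask_sdiag _ _)).
have hY := wedin_step sK (spectral_norm_ge0 _) hs ht (t0 K KN) (XJ Z) (JX W)
  (fun x => G_le Z x uZ)
  (sing_intertwine AE CU ZA (mask_sdiag _ _) (mask_sdiag _ _)).
rewrite ler_pdivlMr ?subr_gt0//.
exact: (wedin_bound (s0 _ KN) (t0 _ KN) (spectral_norm_ge0 _)
  (spectral_norm_ge0 _) (spectral_norm_ge0 _) (X_le _ uW) (X_le _ uZ)
  gap weyl hX hY).
Qed.

(** Split [x] as [W lo W^* x + W hi W^* x]: the projection fixes the first term, which lies in the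
    span of the first K columns, and kills the second, which is orthogonal to them. *)
Lemma orth_proj_first_cols W K (hK : (K <= N)%N) x : W \is unitarymx ->
  x - orth_proj (first_cols W hK) x = W *m (hi K *m (W^t* *m x)).
Proof.
move=> uW; set S := first_cols W hK.
(* [I1] turns column selection into a product: [S = W I1], [lo K = I1 I1^T] and [hi K I1 = 0]. *)
pose I1 : 'M[C]_(N, K) := colsub (widen_ord hK) 1%:M.
have SI : S = W *m I1.
  by rewrite /S /first_cols -[in LHS](mulmx1 W) -mulmx_colsub.
have loE : lo K = I1 *m I1^T.
  apply/matrixP => i j; rewrite !mxE.
  case: (ltnP i K) => iK.
    rewrite (bigD1 (Ordinal iK))//= big1 => [|k ki].
      by rewrite !mxE addr0 -!val_eqE/= eqxx mul1r eq_sym.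
    rewrite !mxE; case: eqP => [ik|]; rewrite ?mul0r//.
    by move: ki; rewrite -val_eqE/= ik eqxx.
  rewrite mul0rn big1// => k _; rewrite !mxE; case: eqP => [ik|].
    by move: iK; rewrite ik /= leqNgt ltn_ord.
  by rewrite mul0r.
have hiI : hi K *m I1 = 0.
  apply/matrixP => i j; rewrite mul_diag_mx !mxE; case: (leqP K i) => iK.
    case: eqP => [ij|]; last by rewrite mulr0.
    by move: iK; rewrite ij /= leqNgt ltn_ord.
  by rewrite mul0r.
set y := W^t* *m x.
have xE : x = W *m (lo K *m y) + W *m (hi K *m y).
  by rewrite -mulmxDr -mulmxDl mask_loD_hi mul1mx /y mulmxA (unitarymxP uW) mul1mx.
have e1 : (W *m (lo K *m y))^T *m proj_ortho S^T = (W *m (lo K *m y))^T.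
  apply: proj_ortho_id; rewrite loE -mulmxA mulmxA -SI trmx_mul.
  exact: submxMl.
have e2 : (W *m (hi K *m y))^T *m proj_ortho S^T = 0.
  apply: proj_ortho_0; apply/orthomx1P.
  suff h : S^t* *m (W *m (hi K *m y)) = 0.
    have eS : ((S^T)^t*)^T = S^t* by rewrite trmxK map_trmx.
    by rewrite -[LHS]trmxK trmx_mul eS trmxK h trmx0.
  rewrite SI adj_mul -!mulmxA (mulmxA (W^t*)) (unitarymxPV uW) mul1mx mulmxA.
  suff -> : I1^t* *m hi K = 0 by rewrite mul0mx.
  have hiT : (hi K)^t* = hi K.
    apply/matrixP => i j; rewrite !mxE eq_sym; case: eqP => [->|_].
      by rewrite !mulr1n rmorph_nat.
    by rewrite !mulr0n rmorph0.
  by rewrite -hiT -adj_mul hiI trmx0 map_mx0.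
rewrite /orth_proj {1 2}xE linearD/= mulmxDl e1 e2 addr0 trmxK.
by rewrite addrC addKr.
Qed.

(** In the coordinates [x] of the vector along [U], the leading part leaks out of the perturbed
    subspace by at most the sin-theta factor, and the tail is bounded by its full norm. *)
Lemma truncation_error (C0 E U V W Z : 'M[C]_N) s t K (hKN : (K < N)%N) x :
  (0 < K)%N -> psdmx C0 -> E \is hermsymmx ->
  is_svd C0 U s V -> is_svd (C0 + E) W t Z ->
  (forall i j, (1 <= i)%N -> (i < j)%N -> (j <= N)%N -> s j < s i) ->
  l2norm (U *m x - orth_proj (first_cols W (ltnW hKN)) (U *m x)) <=
    2 * spectral_norm E / (s K - s K.+1) * l2norm x + l2norm (hi K *m x).
Proof.
move=> K0 hC hE hsvd hsvdt ds.
have [uU _ s0 ds0 _] := hsvd; have [uW uZ t0 dt0 eA] := hsvdt.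
rewrite -/(sdiag N t) in eA.
have eC := psd_svdE hC hsvd ds.
have hA : C0 + E \is hermsymmx.
  apply/is_hermitianmxP; rewrite expr0 scale1r linearD/= map_mxD.
  by rewrite (hermsymmx_adj hC.1) (hermsymmx_adj hE).
have K0N : (0 < K < N)%N by rewrite K0.
have gap : s K.+1 < s K by rewrite ds.
have sinT : spectral_norm (hi K *m W^t* *m U *m lo K) <=
    2 * spectral_norm E / (s K - s K.+1).
  apply: (sin_theta K0N uU uW uZ _ _ _ _ gap erefl eC eA (herm_svd hA eA)).
  - by move=> i iN; exact: s0.
  - by move=> i j /andP[ij jN]; exact: ds0.
  - by move=> i iN; exact: t0.
  - by move=> i j /andP[ij jN]; exact: dt0.
rewrite (orth_proj_first_cols _ _ uW) (l2norm_unitary _ uW).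
(* Insert [lo K + hi K = 1], and double [lo K] by idempotence so that the matrix bounded in [sinT]
   appears. *)
have -> : hi K *m (W^t* *m (U *m x)) =
    hi K *m W^t* *m U *m lo K *m (lo K *m x) + hi K *m (W^t* *m (U *m (hi K *m x))).
  rewrite (mulmxA _ (lo K)) -(mulmxA _ (lo K) (lo K)) mask_idem -!mulmxA.
  by rewrite -!mulmxDr -mulmxDl mask_loD_hi mul1mx.
rewrite (le_trans (l2normD _ _))// lerD//.
  rewrite (le_trans (l2norm_mulmx _ _))// ler_pM ?spectral_norm_ge0 ?l2norm_ge0//.
  exact: l2norm_mask.
rewrite (le_trans (l2norm_mask _ _))//.
by rewrite (l2norm_unitary _ (unitarymx_adj uW)) (l2norm_unitary _ uU).
Qed.

End SinTheta.

(** * Second moments and square roots *)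

Section Expectation.
Context d (T : measurableType d) (R : realType) (P : probability T R).
Local Notation C := R[i].

(* No measurability is needed: the integral of a nonnegative function is a
   supremum over the simple functions below it. *)
Lemma ge0_le_expectation (f g : T -> R) : (forall w, 0 <= f w) ->
  (forall w, f w <= g w) -> ('E_P[f] <= 'E_P[g])%E.
Proof.
move=> f0 fg; rewrite unlock !ge0_integralTE => [|w|w]; rewrite ?lee_fin//.
  apply: ereal_sup_le => _ [h hf <-]; exists h => // w.
  by rewrite (le_trans (hf w))// lee_fin.
exact: le_trans (fg w).
Qed.

Lemma sqr_cmod (z : C) : cmod z ^+ 2 = complex.Re z ^+ 2 + complex.Im z ^+ 2.
Proof. by case: z => x y /=; rewrite sqr_sqrtr// addr_ge0// sqr_ge0. Qed.

Lemma measurable_sqr_cmod (X : T -> C) : cintegrable P X ->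
  measurable_fun setT (fun w => cmod (X w) ^+ 2).
Proof.
move=> [/(measurable_int P)/measurable_EFinP mR].
move=> /(measurable_int P)/measurable_EFinP mI.
under eq_fun do rewrite sqr_cmod.
by apply: measurable_funD; exact: measurable_funX.
Qed.

(** Zero mean turns the variance into the second moment, so each squared modulus has expectation 1;
    the rest is linearity of the integral on nonnegative measurable functions. *)
Lemma expectation_sqr_comb N (a : 'I_N -> T -> C) (b : 'I_N -> R) (k : R) :
  (forall n, cintegrable P (a n)) -> (forall n, cmean P (a n) = 0) ->
  (forall n, cvariance P (a n) = 1%:E) -> (forall n, 0 <= b n) -> 0 <= k ->
  ('E_P[fun w => (\sum_n b n * cmod (a n w) ^+ 2 + k)%R] =
    (\sum_n b n + k)%R%:E)%E.
Proof.
move=> ia ma va b0 k0.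
have mq n := measurable_sqr_cmod (ia n).
have q0 n w : 0 <= cmod (a n w) ^+ 2 by rewrite sqr_ge0.
have bq0 n w : 0 <= b n * cmod (a n w) ^+ 2 by rewrite mulr_ge0.
have q1 n : (\int[P]_w (cmod (a n w) ^+ 2)%:E = 1)%E.
  rewrite -(va n) /cvariance ma unlock; apply: eq_integral => w _.
  by rewrite subr0.
rewrite unlock; under eq_integral do rewrite EFinD -sumEFin.
rewrite ge0_integralD//=; last 2 first.
- by move=> w _; apply: sume_ge0 => n _; rewrite lee_fin.
- apply: emeasurable_sum => n; apply/measurable_EFinP.
  exact: measurable_funM.
rewrite integral_cst//= probability_setT mule1 EFinD; congr (_ + _)%E.
rewrite ge0_integral_sum//=; last 2 first.
- by move=> n; apply/measurable_EFinP; exact: measurable_funM.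
- by move=> n w _; rewrite lee_fin.
rewrite -sumEFin; apply: eq_bigr => n _.
under eq_integral do rewrite EFinM.
rewrite ge0_integralZl//= ?q1 ?mule1// ?lee_fin//.
  by apply/measurable_EFinP.
by move=> w _; rewrite lee_fin.
Qed.

(* AM-GM; if m = 0 the quotient is the junk value 0. *)
Lemma sqrt_le_avg (s m : R) : 0 <= s -> 0 <= m -> (m = 0 -> s = 0) ->
  Num.sqrt s <= (2 * Num.sqrt m)^-1 * s + Num.sqrt m / 2.
Proof.
move=> s0 m0 ms; have [m_eq|mN0] := eqVneq m 0.
  by rewrite m_eq (ms m_eq) sqrtr0 !mulr0 mul0r addr0.
have t0 : 0 < Num.sqrt m by rewrite sqrtr_gt0 lt_def mN0.
have -> : (2 * Num.sqrt m)^-1 * s + Num.sqrt m / 2 =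
    Num.sqrt s + (Num.sqrt s - Num.sqrt m) ^+ 2 / (2 * Num.sqrt m).
  by rewrite -{1}(sqr_sqrtr s0); field; rewrite gt_eqF.
by rewrite lerDl divr_ge0 ?sqr_ge0 ?mulr_ge0 ?sqrtr_ge0.
Qed.

(** This is the equality case of [sqrt_le_avg]: if [s] is random with mean [m], averaging that bound
    gives [sqrt m], which replaces Jensen's inequality. *)
Lemma sqrt_avg (m : R) : 0 <= m ->
  (2 * Num.sqrt m)^-1 * m + Num.sqrt m / 2 = Num.sqrt m.
Proof.
move=> m0; have [->|mN0] := eqVneq m 0; first by rewrite sqrtr0 mulr0 mul0r addr0.
have t0 : 0 < Num.sqrt m by rewrite sqrtr_gt0 lt_def mN0.
by rewrite -{2}(sqr_sqrtr m0); field; rewrite gt_eqF.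
Qed.

(** The indicator form ranges over all coordinates, like the squared norm of a masked vector. *)
Lemma tail_sumE N (s : nat -> R) i : (i <= N)%N ->
  tail_sum N s i = \sum_(n < N) (i <= n)%:R * s n.+1.
Proof.
move=> iN; rewrite /tail_sum big_add1/=.
rewrite -(big_mkord xpredT (fun n => (i <= n)%:R * s n.+1)).
rewrite (big_cat_nat (leq0n i) iN)/= [X in _ = X + _]big1_seq ?add0r => [|n].
  by apply: eq_big_nat => n /andP[-> _]; rewrite mul1r.
by rewrite mem_index_iota => /andP[_ /andP[_ ni]]; rewrite leqNgt ni mul0r.
Qed.

Lemma contrast_sourceE N (U : 'M[C]_N) (s : nat -> R) (a : 'I_N -> T -> C) w :
  contrast_source U s a w =
    U *m \col_n (a n w * (Num.sqrt (s n.+1))%:C).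
Proof.
apply/colP => i; rewrite mxE summxE; apply: eq_bigr => n _.
by rewrite !mxE mulrC.
Qed.

End Expectation.

(* The expected projection error *)
Local Close Scope complex_scope.
Local Close Scope sesquilinear_scope.

Theorem theorem5p3 (R : realType)
  (d : measure_display) (T : measurableType d) (P : probability T R)
  (N K : nat) (hK1 : (1 <= K)%N) (hKN : (K < N)%N)
  (C Cdelta : 'M[R[i]]_N)
  (hC : psdmx C)
  (hCdelta : Cdelta \is hermsymmx)
  (U V Ut Vt : 'M[R[i]]_N) (lam lamt : nat -> R)
  (hsvd : is_svd C U lam V)
  (hsvdt : is_svd (C + Cdelta) Ut lamt Vt)
  (hlam : forall i j : nat, (1 <= i)%N -> (i < j)%N -> (j <= N)%N ->
            lam j < lam i)
  (a : 'I_N -> T -> R[i])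
  (ha_int : forall n, cintegrable P (a n))
  (ha_mean : forall n, cmean P (a n) = 0)
  (ha_var : forall n, cvariance P (a n) = 1%:E) :
  let phi := contrast_source U lam a in
  let phiK := fun w => orth_proj (first_cols Ut (ltnW hKN)) (phi w) in
  let deltaK := lam K - lam K.+1 in
  let eps := tail_sum N lam in
  ('E_P[fun w => l2norm (phi w - phiK w)] <=
    (Num.sqrt (eps K)
     + 2 * spectral_norm Cdelta / deltaK * Num.sqrt (eps 0%N))%:E)%E.
Proof.
cbv zeta; set phi := contrast_source U lam a.
pose phiK w := orth_proj (first_cols Ut (ltnW hKN)) (phi w).
set deltaK := lam K - lam K.+1; set eps := tail_sum N lam.
have [_ _ s0 _ _] := hsvd.
have lam0 n : (n < N)%N -> 0 <= lam n.+1 by move=> nN; rewrite s0.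
pose c := 2 * spectral_norm Cdelta / deltaK.
have c0 : 0 <= c.
  by rewrite divr_ge0 ?mulr_ge0 ?spectral_norm_ge0// subr_ge0 ltW// hlam.
(* [v w] collects the coordinates of [phi w] in the basis of columns of [U]. *)
pose v w : 'cV[R[i]]_N := \col_n (a n w * (Num.sqrt (lam n.+1))%:C%C).
pose q n w := cmod (a n w) ^+ 2.
have vE w (n : 'I_N) : cmod (v w n 0) ^+ 2 = lam n.+1 * q n w.
  rewrite mxE ComplexField.Normc.normcM cmod_real exprMn mulrC.
  by rewrite ger0_norm ?sqrtr_ge0// sqr_sqrtr ?lam0.
have pointwise w : l2norm (phi w - phiK w) <=
    c * l2norm (v w) + l2norm (mask R N (fun i => (K <= i)%N) *m v w).
  rewrite /phiK /phi contrast_sourceE.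
  exact: (truncation_error hKN _ hK1 hC hCdelta hsvd hsvdt hlam).
(* With weights [b i], the sum of the [q n w] is the squared norm of [v w] restricted to coordinates
   [n >= i], and its mean is [eps i]. *)
pose b i (n : 'I_N) := (i <= n)%:R * lam n.+1.
have b0 i n : 0 <= b i n by rewrite mulr_ge0 ?ler0n ?lam0.
have epsE i : (i <= N)%N -> eps i = \sum_n b i n by exact: tail_sumE.
have eps0 i : (i <= N)%N -> 0 <= eps i by move=> iN; rewrite epsE// sumr_ge0.
have avg i w : (i <= N)%N ->
    l2norm (mask R N (fun n => (i <= n)%N) *m v w) <=
    (2 * Num.sqrt (eps i))^-1 * (\sum_n b i n * q n w) + Num.sqrt (eps i) / 2.
  move=> iN; have -> : l2norm (mask R N (fun n => (i <= n)%N) *m v w) =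
      Num.sqrt (\sum_n b i n * q n w).
    congr Num.sqrt; apply: eq_bigr => n _; rewrite maskE.
    rewrite ComplexField.Normc.normcM exprMn vE /b -mulrA; congr (_ * _).
    case: (i <= n)%N; first by rewrite ComplexField.Normc.normc1 expr1n.
    by rewrite ComplexField.Normc.normc0 expr0n.
  apply: sqrt_le_avg; [|exact: eps0|].
    by apply: sumr_ge0 => n _; rewrite mulr_ge0// sqr_ge0.
  (* If [eps i] is 0, all its nonnegative terms vanish, and so does the random sum with these
     weights. *)
  rewrite epsE// => /eqP; rewrite psumr_eq0// => /allP h.
  rewrite big1// => n _; have := h n (mem_index_enum n).
  by move=> /eqP ->; rewrite mul0r.
pose r i := (2 * Num.sqrt (eps i))^-1.
have r0 i : 0 <= r i by rewrite invr_ge0 mulr_ge0 ?sqrtr_ge0.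
pose k := c * (Num.sqrt (eps 0%N) / 2) + Num.sqrt (eps K) / 2.
(* [g] is the sum of the two bounds [avg], at 0 (scaled by [c]) and at K, regrouped as an affine
   combination of the [q n w]. *)
pose g w := \sum_n (c * (r 0%N * b 0%N n) + r K * b K n) * q n w + k.
apply: (@le_trans _ _ ('E_P[g])%E).
  apply: ge0_le_expectation => w; first exact: l2norm_ge0.
  apply: le_trans (pointwise w) _.
  have := avg K w (ltnW hKN).
  have : c * l2norm (v w) <= c * (r 0%N * (\sum_n b 0%N n * q n w)
      + Num.sqrt (eps 0%N) / 2).
    (* At index 0 the mask is the identity. *)
    rewrite ler_wpM2l//; apply: le_trans (avg 0%N w (leq0n _)).
    by apply: l2norm_mono => n; rewrite maskE mul1r.
  rewrite -/(r K) => h1 h2; apply: le_trans (lerD h1 h2) _.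
  rewrite le_eqVlt; apply/orP; left; apply/eqP; rewrite /g /k.
  have -> : \sum_n (c * (r 0%N * b 0%N n) + r K * b K n) * q n w =
      c * (r 0%N * (\sum_n b 0%N n * q n w)) + r K * (\sum_n b K n * q n w).
    rewrite !mulr_sumr -big_split; apply: eq_bigr => n _ /=; ring.
  ring.
have k0 : 0 <= k.
  by apply: addr_ge0; [apply: mulr_ge0 => //|]; rewrite divr_ge0 ?sqrtr_ge0.
have cb0 n : 0 <= c * (r 0%N * b 0%N n) + r K * b K n.
  exact: (addr_ge0 (mulr_ge0 c0 (mulr_ge0 (r0 _) (b0 _ _)))
    (mulr_ge0 (r0 _) (b0 _ _))).
have -> : ('E_P[g] =
    (\sum_n (c * (r 0%N * b 0%N n) + r K * b K n) + k)%R%:E)%E.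
  exact: expectation_sqr_comb.
rewrite lee_fin le_eqVlt; apply/orP; left; apply/eqP.
have -> : \sum_n (c * (r 0%N * b 0%N n) + r K * b K n) =
    c * (r 0%N * eps 0%N) + r K * eps K.
  rewrite !epsE ?(ltnW hKN)// !mulr_sumr -big_split.
  by apply: eq_bigr => n _ /=; ring.
(* After taking expectations, both averages collapse to the square roots of [eps K] and [eps 0]. *)
have hK := sqrt_avg (eps0 K (ltnW hKN)); have h0 := sqrt_avg (eps0 0%N (leq0n _)).
by rewrite -/c /k -[in RHS]hK -[in RHS]h0 /r; ring.
Qed.
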